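(* Let $(G,H)$ be a Hecke pair and let $L$ be a length function on $(G,H)$. If $(G,H)$ has property (RD) with respect to $L$, then $T^\infty_L(G,H)=H^\infty_L(G,H)$. Here both are regarded as sets of functions on $G//H$, an element $a\in T^\infty_L(G,H)\subseteq C^*_r(G,H)$ being identified with the function $a(\delta_H)\in\ell^2(H\backslash G)$.
   Context: $G$ is a discrete group. A pair $(G,H)$ with $H\le G$ is a Hecke pair if every double coset $HgH$ ($g\in G$) is a finite union of left cosets of $H$ (equivalently, every double coset is a finite union of right cosets $Hx$). Let $H\backslash G$ be the set of right cosets $Hg$ and $G//H$ the set of double cosets $HgH$; functions on these sets are regarded as left $H$-invariant, respectively $H$-bi-invariant, functions on $G$. $\mathcal{H}(G,H)$ is the space of finitely supported functions $G//H\to\mathbb{C}$. For $f\in\mathcal{H}(G,H)$ and $\xi\in\mathcal{H}(G,H)$ or $\xi\in\ell^2(H\backslash G)$ put $$(f*\xi)(g)=\sum_{\gamma H\in G/H} f(\gamma)\xi(\gamma^{-1}g)=\sum_{H\gamma\in H\backslash G} f(g\gamma^{-1})\xi(\gamma),\qquad f^*(g)=\overline{f(g^{-1})}.$$ With these operations $\mathcal{H}(G,H)$ is a unital $*$-algebra (the Hecke algebra), and $\lambda(f)\xi=f*\xi$ defines a $*$-representation $\lambda$ of it by bounded operators on $\ell^2(H\backslash G)$. The reduced Hecke $C^*$-algebra $C^*_r(G,H)$ is the norm closure of $\lambda(\mathcal{H}(G,H))$ in $\mathcal{B}(\ell^2(H\backslash G))$. Let $\delta_H\in\ell^2(H\backslash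 G)$ be the characteristic function of the coset $H$. Elements $a\in C^*_r(G,H)$ are identified with the functions $a(\delta_H)$, which are $H$-bi-invariant (the map $a\mapsto a(\delta_H)$ is injective, and $\lambda(f)\delta_H=f$ for $f\in\mathcal{H}(G,H)$). A length function on $(G,H)$ is a function $L:G\to[0,\infty)$ with $L(gh)\le L(g)+L(h)$, $L(g)=L(g^{-1})$ for all $g,h\in G$, $L(1)=0$, and $L(h)=0$ for all $h\in H$; then $L$ is constant on double cosets. For $s\ge 0$ and $f:G//H\to\mathbb{C}$ put $\|f\|_{s,L}=\left(\sum_{Hg\in H\backslash G}|f(g)|^2(1+L(g))^{2s}\right)^{1/2}$. $(G,H)$ has property (RD) with respect to $L$ if there are $C,s>0$ with $\|\lambda(f)\|\le C\|f\|_{s,L}$ for all $f\in\mathcal{H}(G,H)$. Rapidly decreasing functions: $H^s_L(G,H)=\{f:G//H\to\mathbb{C}\,;\ \|f\|_{s,L}<\infty\}$ and $H^\infty_L(G,H)=\bigcap_{s\ge0}H^s_L(G,H)$. Jolissaint algebra: for $r\ge0$ let $P_r$ be the orthogonal projection of $\ell^2(H\backslash G)$ onto the closed span of the characteristic functions of the cosets $Hg$ with $L(g)\le r$. For $0<\alpha<1$, positive integers $q,N$ and $a\in C^*_r(G,H)$ put $$\rho_{\alpha,q,N}(a)=N^q\left(\|(1-P_N)aP_{N-N^\alpha}\|+\|P_{N-N^\alpha}a(1-P_N)\|\right),\qquad \nu_{\alpha,q}(a)=\sup_{N\ge1}\rho_{\alpha,q,N}(a).$$ Then $T^\infty_L(G,H)=\{a\in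 C^*_r(G,H)\,;\ \nu_{\alpha,q}(a)<\infty\ \text{for all }\alpha\in(0,1)\text{ and all positive integers }q\}$. *)

(* Defs.v *)
From HB Require Import structures.
From mathcomp Require Import all_boot all_order all_algebra.
From mathcomp Require Import complex.
From mathcomp Require Import all_classical all_reals all_analysis.

Set Implicit Arguments.
Unset Strict Implicit.
Unset Printing Implicit Defensive.
Import Order.TTheory GRing.Theory Num.Theory.
Import Normc.

Local Open Scope classical_set_scope.
Local Open Scope ring_scope.

(* A subgroup H <= G is a [groupClosed G].  Functions on H\G and on G//H are
   functions G -> R[i] invariant under H on the left, resp. on both sides. *)

Section Cosets.
Variables (G : groupType) (H : groupClosed G).

Definition lcoset (g : G) : set G := [set x | exists2 h, h \in H & x = (g * h)%g].
Definition rcoset (g : G) : set G := [set x | exists2 h, h \in H & x = (h * g)%g].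
Definition dcoset (g : G) : set G :=
  [set x | exists h k, [/\ h \in H, k \in H & x = (h * g * k)%g]].

Definition lcosets : set (set G) := range lcoset.
Definition rcosets : set (set G) := range rcoset.

Definition rep (A : set G) : G := xget 1%g A.

Definition hecke_pair : Prop :=
  forall g, exists D : set G,
    finite_set D /\ dcoset g = \bigcup_(x in D) lcoset x.

Definition left_invariant (T : Type) (f : G -> T) : Prop :=
  forall h g, h \in H -> f (h * g)%g = f g.

Definition bi_invariant (T : Type) (f : G -> T) : Prop :=
  forall h g k, h \in H -> k \in H -> f (h * g * k)%g = f g.

End Cosets.

Section Hecke.
Variables (R : realType) (G : groupType) (H : groupClosed G).
Local Notation C := R[i].

(* Sum of an absolutely summable family of complex numbers. *)
Definition rsum (T : choiceType) (D : set T) (u : T -> R) : R :=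
  fine (\esum_(i in D) (Num.max (u i) 0)%:E)
  - fine (\esum_(i in D) (Num.max (- u i) 0)%:E).

Definition csum (T : choiceType) (D : set T) (u : T -> C) : C :=
  Complex (rsum D (fun i => complex.Re (u i))) (rsum D (fun i => complex.Im (u i))).

Definition l2norm (xi : G -> C) : \bar R :=
  sqrte (\esum_(A in rcosets H) (normc (xi (rep A)) ^+ 2)%:E).

Definition ell2 : set (G -> C) :=
  [set xi | left_invariant H xi /\ (l2norm xi < +oo)%E].

Definition inner (xi eta : G -> C) : C :=
  csum (rcosets H) (fun A => xi (rep A) * conjc (eta (rep A))).

Definition lspan (S : set (G -> C)) : set (G -> C) :=
  [set xi | exists n (c : 'I_n -> C) (v : 'I_n -> G -> C),
     (forall i, S (v i)) /\ xi = (fun g => \sum_(i < n) c i * v i g)].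

Definition l2closure (S : set (G -> C)) : set (G -> C) :=
  [set xi | ell2 xi /\ forall e : R, 0 < e ->
     exists2 eta, S eta & (l2norm (xi \- eta)%R < e%:E)%E].

(* Meaningful when V is a closed linear subspace of ell2 and xi is in ell2. *)
Definition orthproj (V : set (G -> C)) (xi : G -> C) : G -> C :=
  xget (fun=> 0) [set eta | V eta /\ forall zeta, V zeta -> inner (xi \- eta) zeta = 0].

(* Operators on ell2 are represented by total maps on G -> C; only their
   restriction to ell2 is ever used. *)
Definition op : Type := (G -> C) -> (G -> C).

Definition opnorm (a : op) : \bar R :=
  ereal_sup [set l2norm (a xi) | xi in [set xi | ell2 xi /\ (l2norm xi <= 1)%E]].

Definition bounded_op (a : op) : Prop :=
  [/\ forall xi, ell2 xi -> ell2 (a xi),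
      forall (c : C) xi eta, ell2 xi -> ell2 eta ->
        a (fun g => c * xi g + eta g) = (fun g => c * a xi g + a eta g)
    & (opnorm a < +oo)%E].

Definition hecke_alg : set (G -> C) :=
  [set f | bi_invariant H f /\ finite_set [set dcoset H g | g in [set g | f g != 0]]].

(* \sum_(_ \in _) ranges over the finite support of its summand; for f in
   hecke_alg and a Hecke pair, finitely many left cosets contribute. *)
Definition hconv (f xi : G -> C) : G -> C := fun g =>
  \sum_(A \in lcosets H) f (rep A) * xi ((rep A)^-1 * g)%g.

Definition lambda (f : G -> C) : op := hconv f.

Definition reduced_hecke : set op :=
  [set a | bounded_op a /\ forall e : R, 0 < e ->
     exists2 f, hecke_alg f & (opnorm (fun xi => (a xi \- lambda f xi)%R) < e%:E)%E].

Definition delta (g : G) : G -> C := \1_(rcoset H g).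

Definition length_function (L : G -> R) : Prop :=
  [/\ forall g, 0 <= L g,
      forall g h, L (g * h)%g <= L g + L h,
      forall g, L g^-1%g = L g,
      L 1%g = 0
    & forall h, h \in H -> L h = 0].

Variable L : G -> R.

Definition snorm (s : R) (f : G -> C) : \bar R :=
  sqrte (\esum_(A in rcosets H)
    (normc (f (rep A)) ^+ 2 * (1 + L (rep A)) `^ (2 * s))%:E).

Definition property_RD : Prop :=
  exists c s : R, [/\ 0 < c, 0 < s
    & forall f, hecke_alg f -> (opnorm (lambda f) <= c%:E * snorm s f)%E].

Definition Hs (s : R) : set (G -> C) :=
  [set f | bi_invariant H f /\ (snorm s f < +oo)%E].

Definition Hinf : set (G -> C) := \bigcap_(s in [set s : R | 0 <= s]) Hs s.

Definition Pball (r : R) : op :=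
  orthproj (l2closure (lspan [set delta g | g in [set g | L g <= r]])).

Definition Pcompl (r : R) : op := fun xi => xi \- Pball r xi.

Definition rho (alpha : R) (q N : nat) (a : op) : \bar R :=
  let r := N%:R - N%:R `^ alpha in
  ((N%:R ^+ q)%:E *
   (opnorm (Pcompl N%:R \o a \o Pball r) + opnorm (Pball r \o a \o Pcompl N%:R)))%E.

Definition nu (alpha : R) (q : nat) (a : op) : \bar R :=
  ereal_sup [set rho alpha q N a | N in [set N : nat | (1 <= N)%N]].

Definition Tinf : set op :=
  [set a | reduced_hecke a /\ forall (alpha : R) (q : nat),
     0 < alpha < 1 -> (1 <= q)%N -> (nu alpha q a < +oo)%E].

End Hecke.

(* Main.v *)
Require Import Defs.
From mathcomp Require Import all_boot all_order all_algebra.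
From mathcomp Require Import complex finmap.
From mathcomp Require Import all_classical all_reals all_analysis.
From mathcomp Require Import summability.
From mathcomp Require Import lra ring.

Set Implicit Arguments.
Unset Strict Implicit.
Unset Printing Implicit Defensive.
Import Order.TTheory GRing.Theory Num.Theory.
Import numFieldNormedType.Exports.
Import Normc.

Local Open Scope classical_set_scope.
Local Open Scope ring_scope.

(** Convolution by [f] makes sense far beyond finitely supported functions. The
    bound in property (RD) only involves absolute values: applied to the
    truncations of [|f|] to finitely many double cosets, and to [|xi|], it gives
    [abs_conv_bound], an estimate that is uniform over all finite pieces of the
    double sum. Hence for [f] in some [H^s_L] the series defining [f * xi]
    converges absolutely at every point, and the operator [conv_op f] so obtained
    satisfies [||conv_op f|| <= c ||f||_s].

    A rapidly decreasing [f] therefore comes from [conv_op f]. Truncating [f]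
    to large finite sets of double cosets shows that [conv_op f] is a norm
    limit of elements of the Hecke algebra, and [conv_op f] sends [delta_H] to
    [f]. For the Jolissaint seminorms, if [L g > N] and
    [L (gamma^-1 g) <= N - N^alpha], then the triangle inequality forces
    [L gamma > N^alpha]; so only the part of [f] where [L > N^alpha] contributes
    to either corner of the operator, and the [s]-norm of that part is at most
    [N^(-q) ||f||_(s + q/alpha)], which absorbs the factor [N^q]
    ([snorm_far], [conv_op_off_diagonal], [Hinf_sub_Tinf]).

    Conversely let [a] be in the Jolissaint algebra and [f = a delta_H]. As a limit of
    bi-invariant functions, [f] is bi-invariant. Since [delta_H] lies in the
    range of every projection [P_(N - N^alpha)], the seminorms bound the mass of
    [f] on [L > N] by a multiple of [N^(-2q)] for every [q]; writing
    [(1 + L)^(2k)] as a sum over the levels [N < L] then gives [||f||_k] finite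
    ([Tinf_tail], [poly_layer_cake], [Tinf_sub_Hinf]).

    Both halves need the projections in concrete form: [Pball_cutoff] identifies
    [P_r] with multiplication by the indicator function of the ball [L <= r]. *)

#[local] Existing Instance totally_filter.

(** * Moduli of complex numbers *)

Section ComplexModulus.
Variable R : realType.
Implicit Types z w : R[i].

Lemma normc_ge0 z : 0 <= normc z.
Proof. by case: z => a b; exact: sqrtr_ge0. Qed.

Lemma sqr_normc z : normc z ^+ 2 = complex.Re z ^+ 2 + complex.Im z ^+ 2.
Proof. by case: z => a b /=; rewrite sqr_sqrtr // addr_ge0 // sqr_ge0. Qed.

Lemma normc_real (x : R) : normc (Complex x 0) = `|x|.
Proof. by rewrite /= expr0n addr0 sqrtr_sqr. Qed.

Lemma ler_normcD z w : normc (z + w) <= normc z + normc w.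
Proof. exact: le_normcD. Qed.

Lemma ler_normc_sum (I : Type) (r : seq I) (u : I -> R[i]) :
  normc (\sum_(i <- r) u i) <= \sum_(i <- r) normc (u i).
Proof.
elim/big_rec2: _ => [|i y z _ h]; first by rewrite normc0.
by rewrite (le_trans (ler_normcD _ _))// lerD2l.
Qed.

Lemma Re_sum (I : Type) (r : seq I) (u : I -> R[i]) :
  complex.Re (\sum_(i <- r) u i) = \sum_(i <- r) complex.Re (u i).
Proof. by elim/big_rec2: _ => [//|i y [a b] _ <-]; case: (u i). Qed.

Lemma Im_sum (I : Type) (r : seq I) (u : I -> R[i]) :
  complex.Im (\sum_(i <- r) u i) = \sum_(i <- r) complex.Im (u i).
Proof. by elim/big_rec2: _ => [//|i y [a b] _ <-]; case: (u i). Qed.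

Lemma normc_Re_le z : `|complex.Re z| <= normc z.
Proof.
by case: z => a b /=; rewrite -sqrtr_sqr ler_wsqrtr // lerDl sqr_ge0.
Qed.

Lemma normc_Im_le z : `|complex.Im z| <= normc z.
Proof.
by case: z => a b /=; rewrite -sqrtr_sqr ler_wsqrtr // lerDr sqr_ge0.
Qed.

End ComplexModulus.

#[local] Arguments normc : simpl never.

(** * Suprema of finite sums *)

Section FiniteSums.
Variables (R : realType) (T : choiceType).
Implicit Types (D : set T) (u : T -> R) (X Y : {fset T}).

Lemma esum_EFin_leP D u M :
  (\esum_(i in D) (u i)%:E <= M%:E)%E <->
  (forall X, [set` X] `<=` D -> \sum_(i <- X) u i <= M).
Proof.
split=> [le_M X XD|le_M].
  rewrite -lee_fin (le_trans _ le_M)//; apply: ereal_sup_ubound.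
  exists [set` X]; first by split.
  by rewrite fsbig_finite//= set_fsetK sumEFin.
apply: ge_ereal_sup => _ [Y [finY YD] <-].
rewrite fsbig_finite//= sumEFin lee_fin; apply: le_M => i /=.
by rewrite in_fset_set// inE; exact: YD.
Qed.

Lemma sqrte_esum_leP D u M : 0 <= M ->
  (sqrte (\esum_(i in D) (u i)%:E) <= M%:E)%E <->
  (forall X, [set` X] `<=` D -> \sum_(i <- X) u i <= M ^+ 2).
Proof.
move=> M0; rewrite -esum_EFin_leP.
have -> : M%:E = sqrte (M ^+ 2)%:E by rewrite /= sqrtr_sqr ger0_norm.
by rewrite lee_sqrt// lee_fin sqr_ge0.
Qed.

Lemma fset_sum_mono u X Y : (forall i, 0 <= u i) -> {subset X <= Y} ->
  \sum_(i <- X) u i <= \sum_(i <- Y) u i.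
Proof.
move=> u0 XY; rewrite (big_fsetID _ (mem X) Y) /=.
have -> : [fset x in Y | x \in X]%fset = X.
  apply/fsetP => i; rewrite !inE /=; case iX : (i \in X); rewrite ?andbF//.
  by rewrite XY.
by rewrite lerDl; apply: sumr_ge0.
Qed.

(** The set [X] is one whose sum is within [e] of the supremum. *)
Lemma fset_sum_tail D u M e :
  0 < e ->
  (forall X, [set` X] `<=` D -> \sum_(i <- X) u i <= M) ->
  exists X, forall Y, [set` Y] `<=` D -> \sum_(i <- Y | i \notin X) u i <= e.
Proof.
move=> e0 uM.
pose E := [set \sum_(i <- X) u i | X in [set X : {fset T} | [set` X] `<=` D]].
have supE : has_sup E.
  split; first by exists (\sum_(i <- fset0) u i), fset0.
  by exists M => _ [X XD <-]; exact: uM.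
have [_ [X XD <-] ltX] := sup_adherent e0 supE.
exists X => Y YD.
have XYE : \sum_(i <- (X `|` Y)%fset) u i <= sup E.
  apply: ub_le_sup; first by case: supE.
  by exists (X `|` Y)%fset => // i /=; rewrite inE => /orP[/XD|/YD].
have XYX : \sum_(i <- (X `|` Y)%fset) u i =
    \sum_(i <- X) u i + \sum_(i <- Y | i \notin X) u i.
  rewrite [X in _ = _ + X]big_fset_condE /= (big_fsetID _ (mem X)) /=; congr (_ + _);
    apply: eq_fbigl => i; rewrite !inE /=;
    by case: (i \in X); rewrite ?andbF ?andbT.
by move: XYE; rewrite XYX; lra.
Qed.

End FiniteSums.

(** * Unconditionally convergent sums of complex numbers *)

Section UnconditionalSums.
Variables (R : realType) (T : choiceType).
Implicit Types (u v : T -> R[i]) (z w : R[i]).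

(** Convergence of the partial sums along the directed set of finite subsets. Real
    and imaginary parts are separated so that completeness of [R] applies. *)
Definition sums_to u z : Prop :=
  (fun X : {fset T} => \sum_(i <- X) complex.Re (u i)) @ totally --> complex.Re z /\
  (fun X : {fset T} => \sum_(i <- X) complex.Im (u i)) @ totally --> complex.Im z.

Definition usum u : R[i] :=
  Complex (lim ((fun X : {fset T} => \sum_(i <- X) complex.Re (u i)) @ totally))
          (lim ((fun X : {fset T} => \sum_(i <- X) complex.Im (u i)) @ totally)).

(** A finite set nearly realizing the supremum of the absolute sums controls every
    larger finite set, so the partial sums form a Cauchy filter. *)
Lemma abs_bounded_cvg (u : T -> R) M :
  (forall X : {fset T}, \sum_(i <- X) `|u i| <= M) ->
  cvg ((fun X : {fset T} => \sum_(i <- X) u i) @ totally).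
Proof.
move=> uM.
pose E := [set \sum_(i <- X) `|u i| | X in [set: {fset T}]].
have supE : has_sup E.
  split; first by exists (\sum_(i <- fset0) `|u i|), fset0.
  by exists M => _ [X _ <-].
apply/cauchy_cvgP/cauchy_exP => e e0.
have [_ [X _ <-] ltX] := sup_adherent e0 supE.
exists (\sum_(i <- X) u i), X => //= Y XY.
have splitX (v : T -> R) : \sum_(i <- Y) v i =
    \sum_(i <- X) v i + \sum_(i <- [fset x in Y | x \notin X]%fset) v i.
  rewrite (big_fsetID _ (mem X) Y) /=; congr (_ + _).
  apply: eq_fbigl => i; rewrite !inE /=.
  by case iX : (i \in X); rewrite ?andbF// (fsubsetP XY).
have YE : \sum_(i <- Y) `|u i| <= sup E by apply: ub_le_sup; [case: supE|exists Y].
rewrite /ball /= splitX opprD addNKr normrN (le_lt_trans (ler_norm_sum _ _ _))//.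
move: YE; rewrite splitX => YE; lra.
Qed.

Lemma sums_to_usum u M :
  (forall X : {fset T}, \sum_(i <- X) normc (u i) <= M) -> sums_to u (usum u).
Proof.
move=> uM; split; apply: (@abs_bounded_cvg _ M) => X; apply: le_trans (uM X);
  by apply: ler_sum => i _; first [exact: normc_Re_le | exact: normc_Im_le].
Qed.

Lemma usumE u z : sums_to u z -> usum u = z.
Proof.
by case: z => a b [ua ub]; rewrite /usum (cvg_lim _ ua)// (cvg_lim _ ub).
Qed.

Lemma sums_to_linear (c : R[i]) u v z w :
  sums_to u z -> sums_to v w -> sums_to (fun i => c * u i + v i) (c * z + w).
Proof.
move=> [uRe uIm] [vRe vIm]; case: c => a b.
have ReE (x y : R[i]) : complex.Re (Complex a b * x + y) =
  a * complex.Re x - b * complex.Im x + complex.Re y by case: x y => [? ?] [? ?].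
have ImE (x y : R[i]) : complex.Im (Complex a b * x + y) =
  a * complex.Im x + b * complex.Re x + complex.Im y by case: x y => [? ?] [? ?].
split.
  rewrite ReE; under eq_fun do under eq_bigr do rewrite ReE.
  under eq_fun do rewrite big_split /= sumrB -!mulr_sumr.
  by apply: cvgD => //; apply: cvgB; apply: cvgMl_tmp.
rewrite ImE; under eq_fun do under eq_bigr do rewrite ImE.
under eq_fun do rewrite 2!big_split /= -!mulr_sumr.
by apply: cvgD => //; apply: cvgD; apply: cvgMl_tmp.
Qed.

Lemma sums_to_finite u (X0 : {fset T}) z :
  (forall X : {fset T}, {subset X0 <= X} -> \sum_(i <- X) u i = z) -> sums_to u z.
Proof.
move=> uz; split; apply: cvg_near_cst; exists X0 => //= X /fsubsetP X0X;
  by rewrite -?Re_sum -?Im_sum uz.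
Qed.

(** Fatou for finite families: a bound on the partial sums survives in the limit.
    This is how estimates on finite pieces become estimates on operators. *)
Lemma sums_to_sqr_le (B : Type) (F : seq B) (u : B -> T -> R[i]) (z : B -> R[i]) M :
  (forall b, sums_to (u b) (z b)) ->
  (forall X : {fset T}, \sum_(b <- F) normc (\sum_(i <- X) u b i) ^+ 2 <= M) ->
  \sum_(b <- F) normc (z b) ^+ 2 <= M.
Proof.
move=> uz uM.
have cv : (fun X : {fset T} => \sum_(b <- F) normc (\sum_(i <- X) u b i) ^+ 2)
    @ totally --> \sum_(b <- F) normc (z b) ^+ 2.
  apply: cvg_big => [|b _]; first exact: add_continuous.
  under eq_fun do rewrite sqr_normc Re_sum Im_sum; rewrite sqr_normc.
  by case: (uz b) => uRe uIm; apply: cvgD; rewrite !expr2; apply: cvgM.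
by apply: (cvgr_to_le cv); exists fset0 => // X _; exact: uM.
Qed.

End UnconditionalSums.

(** * Cosets and invariant functions *)

Section Cosets.
Variables (G : groupType) (H : groupClosed G).
Implicit Types (g h : G) (A B : set G).

Lemma rep_mem A g : A g -> A (rep A).
Proof. by move=> Ag; apply: (xgetPex 1%g); exists g. Qed.

Lemma rep_rcoset g : exists2 h, h \in H & rep (rcoset H g) = (h * g)%g.
Proof.
by apply: (@rep_mem (rcoset H g) g); exists 1%g; rewrite ?gpred1 ?mul1g.
Qed.

Lemma rep_lcoset g : exists2 h, h \in H & rep (lcoset H g) = (g * h)%g.
Proof.
by apply: (@rep_mem (lcoset H g) g); exists 1%g; rewrite ?gpred1 ?mulg1.
Qed.

Lemma rcosetMl h g : h \in H -> rcoset H (h * g)%g = rcoset H g.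
Proof.
move=> hH; apply/seteqP; split => [_ [k kH ->]|_ [k kH ->]].
  by exists (k * h)%g; [exact: gpredM|rewrite mulgA].
by exists (k * h^-1)%g; [rewrite gpredM// gpredV|rewrite mulgA mulgVK].
Qed.

Lemma lcosetMr g h : h \in H -> lcoset H (g * h)%g = lcoset H g.
Proof.
move=> hH; apply/seteqP; split => [_ [k kH ->]|_ [k kH ->]].
  by exists (h * k)%g; [exact: gpredM|rewrite mulgA].
by exists (h^-1 * k)%g; [rewrite gpredM// gpredV|rewrite mulgA mulgK].
Qed.

Lemma rcoset_rep B : rcosets H B -> rcoset H (rep B) = B.
Proof. by move=> [g _ <-]; have [h hH ->] := rep_rcoset g; exact: rcosetMl. Qed.

Lemma lcoset_rep A : lcosets H A -> lcoset H (rep A) = A.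
Proof. by move=> [g _ <-]; have [h hH ->] := rep_lcoset g; exact: lcosetMr. Qed.

Lemma rcosets_rcoset g : rcosets H (rcoset H g). Proof. by exists g. Qed.

Lemma lcosets_lcoset g : lcosets H (lcoset H g). Proof. by exists g. Qed.

Lemma rep_rcoset_rep B : rcosets H B -> rep (rcoset H (rep B)) = rep B.
Proof. by move=> rB; rewrite rcoset_rep. Qed.

Lemma rcosetP x g : rcoset H g x <-> rcoset H x = rcoset H g.
Proof.
split=> [[h hH ->]|<-]; first exact: rcosetMl.
by exists 1%g; rewrite ?gpred1 ?mul1g.
Qed.

Section Invariance.
Variables (T : Type) (f : G -> T).

Lemma bi_invariant_left : bi_invariant H f -> left_invariant H f.
Proof. by move=> fH h g hH; rewrite -[(h * g)%g]mulg1 fH// gpred1. Qed.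

Lemma bi_invariantMr g k : bi_invariant H f -> k \in H -> f (g * k)%g = f g.
Proof. by move=> fH kH; rewrite -[(g * k)%g]mul1g mulgA fH// gpred1. Qed.

Lemma left_invariant_rep g :
  left_invariant H f -> f (rep (rcoset H g)) = f g.
Proof. by move=> fH; have [h hH ->] := rep_rcoset g; exact: fH. Qed.

Lemma bi_invariant_rep g : bi_invariant H f -> f (rep (lcoset H g)) = f g.
Proof. by move=> fH; have [h hH ->] := rep_lcoset g; exact: bi_invariantMr. Qed.

End Invariance.

(** The union of the double cosets of the points of [P]: the sets to which functions
    are truncated to land in the Hecke algebra. *)
Definition dcosets_of (P : seq G) : set G :=
  [set g | exists2 x, x \in P & dcoset H x g].

Lemma dcoset_id g : dcoset H g g.
Proof. by exists 1%g, 1%g; rewrite gpred1 mul1g mulg1. Qed.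

Lemma dcoset_bi_invariant x : bi_invariant H (dcoset H x).
Proof.
have sub h g k : h \in H -> k \in H -> dcoset H x g -> dcoset H x (h * g * k)%g.
  move=> hH kH [h' [k' [h'H k'H ->]]]; exists (h * h')%g, (k' * k)%g.
  by rewrite !gpredM// !mulgA.
move=> h g k hH kH; apply/propext; split; last exact: sub.
move/(sub h^-1%g _ k^-1%g); rewrite !gpredV => /(_ hH kH).
by rewrite !mulgA mulVg mul1g mulgK.
Qed.

Lemma dcoset_sym x g : dcoset H x g -> dcoset H x = dcoset H g.
Proof.
move=> [h [k [hH kH ->]]]; apply/seteqP; split => _ [h' [k' [h'H k'H ->]]].
  exists (h' * h^-1)%g, (k^-1 * k')%g; rewrite !gpredM ?gpredV//; split=> //.
  by rewrite !mulgA mulgVK mulgK.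
by exists (h' * h)%g, (k * k')%g; rewrite !gpredM// !mulgA.
Qed.

Lemma dcosets_of_bi_invariant P : bi_invariant H (fun g => g \in dcosets_of P).
Proof.
move=> h g k hH kH; apply/idP/idP; rewrite !inE => -[x xP].
  by rewrite dcoset_bi_invariant// => xg; exists x.
by move=> xg; exists x => //; rewrite dcoset_bi_invariant.
Qed.

Lemma finite_lcosets_dcoset x : hecke_pair H ->
  finite_set [set A | lcosets H A /\ dcoset H x (rep A)].
Proof.
move=> /(_ x)[D [finD ->]]; apply: (sub_finite_set _ (finite_image (lcoset H) finD)).
move=> A /= [lA [y Dy [h hH e]]]; exists y => //.
by rewrite -(lcoset_rep lA) e lcosetMr.
Qed.

Lemma finite_lcosets_dcosets_of P : hecke_pair H ->
  finite_set [set A | lcosets H A /\ dcosets_of P (rep A)].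
Proof.
move=> hp; apply: (@sub_finite_set _ _
  (\bigcup_(x in [set` P]) [set A | lcosets H A /\ dcoset H x (rep A)])).
  by move=> A /= [lA [x xP xA]]; exists x.
by apply: bigcup_finite => // x _; exact: finite_lcosets_dcoset.
Qed.

End Cosets.

(** * Weighted square norms *)

Lemma in_bool_set (T : Type) (p : pred T) x : (x \in [set x | p x]) = p x.
Proof. by apply/idP/idP; rewrite inE. Qed.

Section Cutoff.
Variables (R : realType) (T : Type).

Definition cutoff (S : set T) (f : T -> R[i]) : T -> R[i] :=
  fun x => if x \in S then f x else 0.

Lemma normc_cutoff_le (S : set T) f g : normc (cutoff S f g) <= normc (f g).
Proof. by rewrite /cutoff; case: ifP => _; rewrite ?normc0 ?normc_ge0. Qed.

End Cutoff.

Section Norms.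
Variables (R : realType) (G : groupType) (H : groupClosed G) (L : G -> R).
Implicit Types f xi : G -> R[i].

Lemma l2norm_leP xi M : 0 <= M -> (l2norm H xi <= M%:E)%E <->
  (forall X : {fset set G}, [set` X] `<=` rcosets H ->
    \sum_(B <- X) normc (xi (rep B)) ^+ 2 <= M ^+ 2).
Proof. exact: sqrte_esum_leP. Qed.

Lemma snorm_leP t f K : 0 <= K -> (snorm H L t f <= K%:E)%E <->
  (forall X : {fset set G}, [set` X] `<=` rcosets H ->
    \sum_(B <- X) normc (f (rep B)) ^+ 2 * (1 + L (rep B)) `^ (2 * t) <= K ^+ 2).
Proof. exact: sqrte_esum_leP. Qed.

Lemma l2norm_mono xi eta :
  (forall B, rcosets H B -> normc (xi (rep B)) <= normc (eta (rep B))) ->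
  (l2norm H xi <= l2norm H eta)%E.
Proof.
move=> h; rewrite /l2norm lee_sqrt.
  apply: le_esum => B rB; rewrite lee_fin ler_sqr ?nnegrE ?normc_ge0//; exact: h.
by apply: esum_ge0 => B _; rewrite lee_fin sqr_ge0.
Qed.

Lemma snorm_mono t f f' : (forall g, normc (f g) <= normc (f' g)) ->
  (snorm H L t f <= snorm H L t f')%E.
Proof.
move=> h; rewrite /snorm lee_sqrt.
  apply: le_esum => B rB; rewrite lee_fin ler_wpM2r ?powR_ge0//.
  by rewrite ler_sqr ?nnegrE ?normc_ge0.
by apply: esum_ge0 => B _; rewrite lee_fin mulr_ge0 ?sqr_ge0 ?powR_ge0.
Qed.

Lemma l2norm_ge0 xi : (0 <= l2norm H xi)%E. Proof. exact: sqrte_ge0. Qed.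

Lemma normc_le_l2norm xi g M : 0 <= M -> left_invariant H xi ->
  (l2norm H xi <= M%:E)%E -> normc (xi g) <= M.
Proof.
move=> M0 xiH /(l2norm_leP _ M0)/(_ [fset rcoset H g]%fset).
rewrite big_seq_fset1 left_invariant_rep// ler_sqr ?nnegrE ?normc_ge0//.
by apply=> B /=; rewrite inE => /eqP ->; exact: rcosets_rcoset.
Qed.

Lemma l2norm_bounded xi : (l2norm H xi < +oo)%E ->
  exists2 M : R, 0 < M & (l2norm H xi <= M%:E)%E.
Proof.
move=> fin; have finE : l2norm H xi \is a fin_num by rewrite ge0_fin_numE// l2norm_ge0.
exists (fine (l2norm H xi) + 1); first by rewrite ltr_wpDl// fine_ge0// l2norm_ge0.
by rewrite EFinD fineK// leeDl.
Qed.

Lemma snorm_bounded t f : (snorm H L t f < +oo)%E ->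
  exists2 K : R, 0 <= K & (snorm H L t f <= K%:E)%E.
Proof.
move=> fin; have n0 : (0 <= snorm H L t f)%E by exact: sqrte_ge0.
by exists (fine (snorm H L t f)); rewrite ?fine_ge0// fineK// ge0_fin_numE.
Qed.

Lemma ell2_cutoff (S : set G) xi : left_invariant H (fun g => g \in S) ->
  ell2 H xi -> ell2 H (cutoff S xi).
Proof.
move=> SH [xiH xifin]; split; first by move=> h g hH; rewrite /cutoff SH// xiH.
by apply: le_lt_trans xifin; apply: l2norm_mono => B _; exact: normc_cutoff_le.
Qed.

Lemma bi_invariant_cutoff (S : set G) f : bi_invariant H (fun g => g \in S) ->
  bi_invariant H f -> bi_invariant H (cutoff S f).
Proof. by move=> SH fH h g k hH kH; rewrite /cutoff SH// fH. Qed.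

Lemma hecke_alg_cutoff f P :
  bi_invariant H f -> hecke_alg H (cutoff (dcosets_of H P) f).
Proof.
move=> fH; split; first exact: bi_invariant_cutoff (dcosets_of_bi_invariant _) _.
apply: (sub_finite_set _ (finite_image (dcoset H) (finite_seq P))).
move=> _ [g /= + <-]; rewrite /cutoff; case: ifP; last by rewrite eqxx.
by rewrite inE => -[x xP xg] _; exists x => //; exact: dcoset_sym.
Qed.

(** The finitely many double cosets in the definition are turned into a list of
    representatives. *)
Lemma hecke_alg_support f : hecke_alg H f ->
  exists P, forall g, f g != 0 -> dcosets_of H P g.
Proof.
move=> [fH fin]; pose D := [set dcoset H g | g in [set g | f g != 0]].
exists [seq rep Q | Q <- fset_set D] => g fg; exists (rep (dcoset H g)).
  by apply: map_f; rewrite in_fset_set// inE; exists g.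
rewrite -(dcoset_sym (rep_mem (dcoset_id H g))); exact: dcoset_id.
Qed.

(** The summand of [(f * xi)(g)], extended by zero to all sets so that sums can range
    over arbitrary finite families of sets. *)
Definition conv_term f xi g : set G -> R[i] :=
  cutoff (lcosets H) (fun A => f (rep A) * xi ((rep A)^-1 * g)%g).

(** The Hecke condition makes the support of the summand finite, so the sum
    in [hconv] is not the default value of an infinite support. *)
Lemma hconv_sum f : hecke_pair H -> hecke_alg H f ->
  exists X0 : {fset set G}, forall xi g (X : {fset set G}), {subset X0 <= X} ->
  hconv H f xi g = \sum_(A <- X) conv_term f xi g A.
Proof.
move=> hp /hecke_alg_support[P fP].
exists (fset_set [set A | lcosets H A /\ dcosets_of H P (rep A)]).
move=> xi g X X0X; rewrite /hconv fsbig_mkcond; apply: fsbigTE => A AX.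
rewrite /patch; case: ifP => // lA; apply/eqP; rewrite mulf_eq0.
case: (eqVneq (f (rep A)) 0) => //= fA.
case/negP: AX; apply: X0X; rewrite in_fset_set; last exact: finite_lcosets_dcosets_of.
by rewrite inE; split; [rewrite -inE|exact: fP].
Qed.

End Norms.

(** * Property (RD) as an absolute convergence estimate *)

Section ConvolutionBound.
Variables (R : realType) (G : groupType) (H : groupClosed G) (L : G -> R).
Variables (c s : R).
Hypotheses (hp : hecke_pair H) (c0 : 0 < c).
Hypothesis RD : forall f, hecke_alg H f ->
  (opnorm H (lambda H f) <= c%:E * snorm H L s f)%E.
Implicit Types f xi : G -> R[i].

(** Only finitely many left cosets occur in [X], so [|f|] may be truncated to
    their double cosets. The truncation is in the Hecke algebra, (RD) applies to it
    and to [|xi| / M], and as all terms are nonnegative the full convolution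
    dominates the partial sum over [X]. *)
Lemma abs_conv_bound f xi K M (F X : {fset set G}) :
  bi_invariant H f -> left_invariant H xi -> 0 <= K -> 0 < M ->
  (snorm H L s f <= K%:E)%E -> (l2norm H xi <= M%:E)%E ->
  [set` F] `<=` rcosets H ->
  \sum_(B <- F) (\sum_(A <- X) normc (conv_term H f xi (rep B) A)) ^+ 2
    <= (c * K * M) ^+ 2.
Proof.
move=> fH xiH K0 M0 fK xiM FH.
pose S := dcosets_of H [seq rep A | A <- X].
pose absf : G -> R[i] := fun g => Complex (normc (f g)) 0.
pose f0 := cutoff S absf.
pose xi0 : G -> R[i] := fun g => Complex (normc (xi g) / M) 0.
have f0H : hecke_alg H f0.
  by apply: hecke_alg_cutoff => h g k hH kH; rewrite /absf fH.
have xi0n : (l2norm H xi0 <= 1%:E)%E.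
  apply/l2norm_leP => // Y YH.
  under eq_bigr do rewrite normc_real normrM exprMn (ger0_norm (normc_ge0 _)).
  rewrite -mulr_suml real_normK ?num_real// exprVn ler_pdivrMr ?exprn_gt0//.
  rewrite expr1n mul1r; apply: (l2norm_leP H xi (ltW M0)).1 => //.
have xi0E : ell2 H xi0.
  split; last by rewrite (le_lt_trans xi0n)// ltry.
  by move=> h g hH; rewrite /xi0 xiH.
have opf0 : (l2norm H (lambda H f0 xi0) <= (c * K)%:E)%E.
  apply: (@le_trans _ _ (opnorm H (lambda H f0))).
    by apply: ereal_sup_ubound; exists xi0.
  rewrite (le_trans (RD f0H))// EFinM lee_pmul2l// ?lte_fin//.
  apply: le_trans fK; apply: snorm_mono => g; apply: le_trans (normc_cutoff_le _ _ _) _.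
  by rewrite normc_real ger0_norm ?normc_ge0.
have {opf0} := (l2norm_leP H _ (mulr_ge0 (ltW c0) K0)).1 opf0 F FH.
have [X0 hX0] := hconv_sum hp f0H.
move=> h; rewrite exprMn -ler_pdivrMr ?exprn_gt0//; apply: le_trans h.
rewrite -exprVn mulr_suml; apply: ler_sum => B _.
rewrite -exprMn ler_sqr ?nnegrE ?normc_ge0//; last first.
  by rewrite divr_ge0 ?(ltW M0)// sumr_ge0// => A _; exact: normc_ge0.
rewrite /lambda (hX0 _ _ (X `|` X0)%fset); last by move=> A AX0; rewrite inE AX0 orbT.
apply: le_trans (le_trans (ler_norm _) (normc_Re_le _)).
have ReE A : complex.Re (conv_term H f0 xi0 (rep B) A) =
   normc (conv_term H (cutoff S f) xi (rep B) A) / M.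
  rewrite /conv_term /cutoff; case: ifP => _; last by rewrite normc0 mul0r.
  rewrite /f0 /cutoff; case: ifP => _; last by rewrite !mul0r normc0 mul0r.
  by rewrite /absf /xi0 normcM /= mul0r subr0 mulrA.
rewrite Re_sum; under [leRHS]eq_bigr do rewrite ReE.
rewrite -mulr_suml ler_pM2r ?invr_gt0//.
apply: (@le_trans _ _ (\sum_(A <- X) normc (conv_term H (cutoff S f) xi (rep B) A))).
  rewrite !big_seq; apply: ler_sum => A AX; rewrite le_eqVlt; apply/orP; left.
  apply/eqP; rewrite /conv_term /cutoff; case: ifP => // lA.
  rewrite /cutoff ifT// inE; exists (rep A); first exact: map_f.
  exact: dcoset_id.
apply: fset_sum_mono => [A|A AX]; [exact: normc_ge0|by rewrite inE AX].
Qed.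

End ConvolutionBound.

(** * Convolution operators with infinite support *)

Section ConvolutionOperator.
Variables (R : realType) (G : groupType) (H : groupClosed G) (L : G -> R).
Implicit Types (f xi eta : G -> R[i]) (a : op R G).

(** Convolution by [f], evaluated at the representative of the coset [H g]. For
    bi-invariant [f] and left-invariant [xi] this is the usual formula at [g], since
    replacing [g] by [h g] permutes the left cosets; choosing the representative
    makes left invariance of the result immediate. *)
Definition conv_op f : op R G :=
  fun xi g => usum (conv_term H f xi (rep (rcoset H g))).

Lemma opnorm_leP a M : (opnorm H a <= M)%E <->
  (forall xi, ell2 H xi -> (l2norm H xi <= 1)%E -> (l2norm H (a xi) <= M)%E).
Proof.
split=> [aM xi xiH xi1|aM].
  by apply: le_trans aM; apply: ereal_sup_ubound; exists xi.
by apply: ge_ereal_sup => _ [xi [xiH xi1] <-]; exact: aM.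
Qed.

Lemma conv_op_left_invariant f xi : left_invariant H (conv_op f xi).
Proof. by move=> h g hH; rewrite /conv_op rcosetMl. Qed.

Lemma deltaE g x : delta R H g x = (rcoset H x == rcoset H g)%:R.
Proof.
by rewrite /delta indicE; congr (nat_of_bool _)%:R; apply/idP/eqP;
  rewrite inE => /rcosetP.
Qed.

Lemma delta1E x : delta R H 1%g x = (x \in H)%:R.
Proof.
rewrite deltaE; congr (nat_of_bool _)%:R; apply/eqP/idP => [/rcosetP|xH].
  by move=> [h hH ->]; rewrite mulg1.
by rewrite -[x]mulg1 rcosetMl.
Qed.

Lemma delta_left_invariant g : left_invariant H (delta R H g).
Proof. by move=> h x hH; rewrite !deltaE rcosetMl. Qed.

Lemma delta_l2norm_le1 g : (l2norm H (delta R H g) <= 1)%E.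
Proof.
apply/(@l2norm_leP R G H _ 1 ler01) => X XH; rewrite expr1n.
have dB B : rcosets H B ->
    normc (delta R H g (rep B)) ^+ 2 = (B == rcoset H g)%:R.
  by move=> rB; rewrite deltaE rcoset_rep//; case: (_ == _);
    rewrite ?normc0 ?normc1 ?expr0n ?expr1n.
rewrite big_seq; under eq_bigr => B BX do rewrite (dB B (XH _ BX)).
rewrite -big_seq; have [gX|gX] := boolP (rcoset H g \in X); last first.
  rewrite big_seq big1 ?ler01// => B BX; case: eqP => // BE.
  by rewrite -BE BX in gX.
rewrite (big_fsetD1 _ gX) /= eqxx big_seq big1 ?addr0// => B.
by rewrite !inE => /andP[/negbTE ->].
Qed.

Lemma delta_ell2 g : ell2 H (delta R H g).
Proof.
split; first exact: delta_left_invariant.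
exact: le_lt_trans (delta_l2norm_le1 g) (ltry _).
Qed.

(** The only left coset [A] with [A^-1 g] meeting [H] is [g H]. *)
Lemma sums_to_delta f g : bi_invariant H f ->
  sums_to (conv_term H f (delta R H 1%g) g) (f g).
Proof.
move=> fH; apply: (@sums_to_finite _ _ _ [fset lcoset H g]%fset) => X X0X.
have gX : lcoset H g \in X by apply: X0X; rewrite inE.
rewrite (big_fsetD1 _ gX) /= big_seq [X in _ + X]big1 ?addr0.
  rewrite /conv_term /cutoff ifT; last by rewrite inE; exact: lcosets_lcoset.
  rewrite bi_invariant_rep// delta1E.
  have [h hH ->] := rep_lcoset H g.
  by rewrite invgM mulgVK gpredV hH mulr1.
move=> A; rewrite !inE => /andP[Ag _]; rewrite /conv_term /cutoff; case: ifP => //.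
rewrite inE => lA; rewrite delta1E.
have [AgH|_] := boolP (_ \in H); last by rewrite mulr0.
case/negP: Ag; rewrite -(lcoset_rep lA); apply/eqP.
by rewrite -(lcosetMr (rep A) AgH) mulVKg.
Qed.

Lemma hconv_sums_to f xi g : hecke_pair H -> hecke_alg H f ->
  sums_to (conv_term H f xi g) (hconv H f xi g).
Proof.
move=> hp fH; have [X0 hX0] := hconv_sum hp fH.
by apply: (@sums_to_finite _ _ _ X0) => X X0X; rewrite -hX0.
Qed.

Lemma hconv_delta f g : hecke_pair H -> hecke_alg H f ->
  hconv H f (delta R H 1%g) g = f g.
Proof.
move=> hp fH; have := hconv_sums_to (delta R H 1%g) g hp fH.
by move=> /usumE <-; apply: usumE; apply: sums_to_delta; case: fH.
Qed.

Lemma conv_op_delta f : bi_invariant H f -> conv_op f (delta R H 1%g) = f.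
Proof.
move=> fH; apply/funext => g; rewrite /conv_op (usumE (sums_to_delta _ fH)).
by rewrite left_invariant_rep//; exact: bi_invariant_left.
Qed.

(** A finite set of cosets carries all but [e^2] of the convergent sum, and so do
    their double cosets. *)
Lemma snorm_tail t f e : (snorm H L t f < +oo)%E -> 0 < e ->
  exists P, (snorm H L t (cutoff (~` dcosets_of H P) f) <= e%:E)%E.
Proof.
move=> /snorm_bounded[K K0 /(snorm_leP H L t f K0) fK] e0.
have [X fX] := fset_sum_tail (exprn_gt0 2 e0) fK.
exists [seq rep B | B <- X]; apply/snorm_leP; first exact: ltW.
move=> Y YH; apply: le_trans (fX Y YH); rewrite [leRHS]big_mkcond.
apply: ler_sum => B _; case: ifPn => [_|/negPn BX].
  by rewrite ler_wpM2r ?powR_ge0// ler_sqr ?nnegrE ?normc_ge0// normc_cutoff_le.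
rewrite /cutoff ifF ?normc0 ?expr0n ?mul0r//.
apply/negP; rewrite inE; apply; exists (rep B); first exact: map_f.
exact: dcoset_id.
Qed.

End ConvolutionOperator.

Section RapidDecayOperator.
Variables (R : realType) (G : groupType) (H : groupClosed G) (L : G -> R).
Variables (c s : R).
Hypotheses (hp : hecke_pair H) (c0 : 0 < c).
Hypothesis RD : forall f, hecke_alg H f ->
  (opnorm H (lambda H f) <= c%:E * snorm H L s f)%E.
Implicit Types f xi eta : G -> R[i].

Lemma conv_op_sums_to f xi g : Hs H L s f -> ell2 H xi ->
  sums_to (conv_term H f xi (rep (rcoset H g))) (conv_op H f xi g).
Proof.
move=> [fH /snorm_bounded[K K0 fK]] [xiH /l2norm_bounded[M M0 xiM]].
apply: (@sums_to_usum _ _ _ (c * K * M)) => X.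
have FH : [set` [fset rcoset H g]%fset] `<=` rcosets H.
  by move=> B /=; rewrite inE => /eqP ->; exact: rcosets_rcoset.
have := abs_conv_bound hp c0 RD X fH xiH K0 M0 fK xiM FH.
rewrite big_seq_fset1 ler_sqr// nnegrE.
  by apply: sumr_ge0 => A _; exact: normc_ge0.
by rewrite !mulr_ge0// ltW.
Qed.

Lemma conv_op_l2norm f xi K M : bi_invariant H f -> left_invariant H xi ->
  0 <= K -> 0 < M -> (snorm H L s f <= K%:E)%E -> (l2norm H xi <= M%:E)%E ->
  (l2norm H (conv_op H f xi) <= (c * K * M)%:E)%E.
Proof.
move=> fH xiH K0 M0 fK xiM; apply/l2norm_leP; first by rewrite !mulr_ge0// ltW.
move=> F FH; apply: (@sums_to_sqr_le _ _ _ F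
  (fun B => conv_term H f xi (rep (rcoset H (rep B))))).
  move=> B; apply: conv_op_sums_to; split=> //; first by rewrite (le_lt_trans fK) ?ltry.
  by rewrite (le_lt_trans xiM) ?ltry.
move=> X; apply: le_trans (abs_conv_bound hp c0 RD X fH xiH K0 M0 fK xiM FH).
rewrite !big_seq; apply: ler_sum => B /FH rB; rewrite rep_rcoset_rep//.
rewrite ler_sqr ?nnegrE ?normc_ge0 ?sumr_ge0//; first exact: ler_normc_sum.
by move=> A _; exact: normc_ge0.
Qed.

Lemma conv_op_opnorm f K : bi_invariant H f -> 0 <= K ->
  (snorm H L s f <= K%:E)%E -> (opnorm H (conv_op H f) <= (c * K)%:E)%E.
Proof.
move=> fH K0 fK; apply/opnorm_leP => xi [xiH _] xi1.
by rewrite -[c * K]mulr1; apply: conv_op_l2norm.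
Qed.

Lemma conv_op_bounded f : Hs H L s f -> bounded_op H (conv_op H f).
Proof.
move=> fHs; have [fH /snorm_bounded[K K0 fK]] := fHs; split.
- move=> xi [xiH /l2norm_bounded[M M0 xiM]]; split; first exact: conv_op_left_invariant.
  exact: le_lt_trans (conv_op_l2norm fH xiH K0 M0 fK xiM) (ltry _).
- move=> z xi eta xiH etaH; apply/funext => g; apply: usumE.
  have := sums_to_linear z (conv_op_sums_to g fHs xiH) (conv_op_sums_to g fHs etaH).
  congr sums_to; apply/funext => A; rewrite /conv_term /cutoff; case: ifP => _.
    by rewrite mulrDr mulrCA.
  by rewrite mulr0 addr0.
- exact: le_lt_trans (conv_op_opnorm fH K0 fK) (ltry _).
Qed.

(** [conv_op f] minus convolution by a truncation of [f] is convolution by the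
    discarded tail, whose [s]-norm is small by [snorm_tail]. *)
Lemma conv_op_reduced f : Hs H L s f -> reduced_hecke H (conv_op H f).
Proof.
move=> fHs; split; first exact: conv_op_bounded.
move=> e e0; have [fH ffin] := fHs.
have e'0 : 0 < e / (2 * c) by rewrite divr_gt0// mulr_gt0.
have [P fP] := snorm_tail ffin e'0.
exists (cutoff (dcosets_of H P) f); first exact: hecke_alg_cutoff.
apply: (@le_lt_trans _ _ (e / 2)%:E); last first.
  by rewrite lte_fin ltr_pdivrMr// ltr_pMr// ltr1n.
apply/opnorm_leP => xi xiE xi1.
apply: (@le_trans _ _ (l2norm H (conv_op H (cutoff (~` dcosets_of H P) f) xi))).
  apply: l2norm_mono => B rB; rewrite le_eqVlt; apply/orP; left; apply/eqP; congr normc.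
  have uf := conv_op_sums_to (rep B) fHs xiE.
  have := hconv_sums_to xi (rep B) hp (hecke_alg_cutoff P fH).
  rewrite rep_rcoset_rep// in uf => u0.
  have /usumE := sums_to_linear (-1) u0 uf.
  rewrite mulN1r addrC => E; apply: etrans (esym E) _.
  rewrite /conv_op rep_rcoset_rep//; congr usum.
  apply/funext => A; rewrite /conv_term /cutoff in_setC.
  case: ifP => _; last by rewrite mulr0 addr0.
  by case: ifP => _ /=; rewrite ?mul0r ?mulr0 ?add0r// mulN1r addNr.
have := conv_op_opnorm _ (ltW e'0) fP.
rewrite (_ : c * _ = e / 2); last by rewrite invfM; field; rewrite gt_eqF.
move=> h; apply: (opnorm_leP _ _ _).1 xiE xi1; apply: h.
apply: bi_invariant_cutoff => // h g k hH kH; rewrite !in_setC.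
by rewrite dcosets_of_bi_invariant.
Qed.

End RapidDecayOperator.

(** * The projections onto balls *)

Lemma csum_single (R : realType) (T : choiceType) (D : set T) (u : T -> R[i]) i0 :
  D i0 ->
  (forall i, D i -> i != i0 -> u i = 0) -> csum D u = u i0.
Proof.
move=> Di0 u0.
have esum_single (v : T -> R) : 0 <= v i0 -> (forall i, D i -> i != i0 -> v i = 0) ->
    (\esum_(i in D) (v i)%:E)%E = (v i0)%:E.
  move=> v0 vi; apply/eqP; rewrite eq_le; apply/andP; split.
    apply/esum_EFin_leP => X XD; have [iX|iX] := boolP (i0 \in X).
      rewrite (big_fsetD1 _ iX) /= big_seq big1 ?addr0// => i.
      by rewrite !inE => /andP[i_ne iX']; rewrite vi//; exact: XD.
    rewrite big_seq big1// => i iX'; rewrite vi//; first exact: XD.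
    by apply: contraNneq iX => <-.
  apply: esum_ge; exists [set i0]; last by rewrite fsbig_set1.
  by split=> // i ->.
have rsum_single (v : T -> R) : (forall i, D i -> i != i0 -> v i = 0) ->
    rsum D v = v i0.
  move=> vi; rewrite /rsum !esum_single ?le_max ?lexx ?orbT//=.
  - by case: (lerP (v i0) 0) => v0; [rewrite max_l ?oppr_ge0// sub0r opprK|
      rewrite max_r ?oppr_le0 ?subr0// ltW].
  - by move=> i Di ne; rewrite vi// oppr0 maxxx.
  - by move=> i Di ne; rewrite vi// maxxx.
rewrite /csum !rsum_single; first by case: (u i0).
  by move=> i Di ne; rewrite u0.
by move=> i Di ne; rewrite u0.
Qed.

Section Projections.
Variables (R : realType) (G : groupType) (H : groupClosed G) (L : G -> R).
Hypothesis lf : length_function H L.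
Implicit Types xi eta zeta : G -> R[i].

Lemma length_bi_invariant : bi_invariant H L.
Proof.
have [L0 LM LV _ LH] := lf.
have le h g k : h \in H -> k \in H -> L (h * g * k)%g <= L g.
  move=> hH kH; rewrite (le_trans (LM _ _))// (LH k)// addr0.
  by rewrite (le_trans (LM _ _))// (LH h)// add0r.
move=> h g k hH kH; apply/eqP; rewrite eq_le le//=.
have := le h^-1%g (h * g * k)%g k^-1%g; rewrite !gpredV => /(_ hH kH).
by rewrite !mulgA mulVg mul1g mulgK.
Qed.

Lemma length_set_bi_invariant (p : pred R) :
  bi_invariant H (fun g => g \in [set g | p (L g)]).
Proof. by move=> h g k hH kH; rewrite !in_bool_set length_bi_invariant. Qed.

Let ball_space r := l2closure H (lspan [set delta R H g | g in [set g | L g <= r]]).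

Lemma length_rep g : L (rep (rcoset H g)) = L g.
Proof. by apply: left_invariant_rep; exact: bi_invariant_left length_bi_invariant. Qed.

Lemma length_rcoset x g : rcoset H x = rcoset H g -> L x = L g.
Proof. by move=> e; rewrite -length_rep e length_rep. Qed.

(** Combinations of the [delta g] with [L g <= r] vanish where [L > r], and norm
    convergence implies pointwise convergence. *)
Lemma ball_space_supp r xi g : ball_space r xi -> r < L g -> xi g = 0.
Proof.
move=> [[xiH _] xicl] rg; apply: eq0_normc; apply/eqP; rewrite eq_le normc_ge0 andbT.
apply/ler_addgt0Pl => e e0; rewrite addr0.
have [eta [n [z [v [vd etaE]]]] lt_e] := xicl e e0.
have etaH : left_invariant H eta.
  move=> h x hH; rewrite etaE; apply: eq_bigr => i _; have [y _ <-] := vd i.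
  by rewrite delta_left_invariant.
have eta0 : eta g = 0.
  rewrite etaE big1// => i _; have [y /= yr <-] := vd i.
  rewrite deltaE; case: eqP => [/length_rcoset Lg|_]; last by rewrite mulr0.
  by move: rg; rewrite Lg ltNge yr.
have -> : xi g = (xi \- eta) g by rewrite /= eta0 subr0.
apply: normc_le_l2norm (ltW e0) _ (ltW lt_e).
by move=> h x hH /=; rewrite xiH// etaH.
Qed.

Lemma ball_space_delta r g : L g <= r -> ball_space r (delta R H g).
Proof.
move=> gr; split; first exact: delta_ell2.
move=> e e0; exists (delta R H g).
  exists 1%N, (fun=> 1), (fun=> delta R H g); split; first by move=> _; exists g.
  by apply/funext => x; rewrite big_ord1 mul1r.
apply: (@le_lt_trans _ _ 0%:E); last by rewrite lte_fin.
apply/l2norm_leP => // X _; rewrite big1// => B _ /=.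
by rewrite subrr normc0 expr0n.
Qed.

(** The finite combinations of the [delta g] with the values of [xi] as coefficients
    approximate the cutoff. *)
Lemma ball_space_cutoff r xi : ell2 H xi -> ball_space r (cutoff [set g | L g <= r] xi).
Proof.
move=> xiE; set S := [set g | _]; split.
  apply: ell2_cutoff => //; apply: bi_invariant_left.
  exact: (length_set_bi_invariant (fun x => x <= r)).
move=> e e0; have [_ /l2norm_bounded[M M0 /(l2norm_leP _ _ (ltW M0)) xiM]] := xiE.
have e20 : 0 < e / 2 by rewrite divr_gt0.
have [X0 tail] := fset_sum_tail (exprn_gt0 2 e20) xiM.
pose X := [seq B <- X0 | `[< rcosets H B >] && (L (rep B) <= r)].
have XP B : B \in X -> rcosets H B /\ L (rep B) <= r.
  by rewrite mem_filter => /andP[/andP[/asboolP]].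
pose eta g := \sum_(B <- X) xi (rep B) * delta R H (rep B) g.
have etaE B : rcosets H B -> eta (rep B) = if B \in X then xi (rep B) else 0.
  move=> rB; rewrite /eta; have dE B' : B' \in X ->
      xi (rep B') * delta R H (rep B') (rep B) = if B' == B then xi (rep B) else 0.
    move=> /XP[rB' _]; rewrite deltaE !rcoset_rep// eq_sym.
    by case: eqP => [->|_]; rewrite ?mulr1 ?mulr0.
  rewrite big_seq (eq_bigr _ dE) -big_seq.
  have [BX|BX] := boolP (B \in X).
    rewrite (bigD1_seq B BX); last exact: filter_uniq (fset_uniq X0).
    rewrite ifT; last exact: eqxx.
    rewrite big1; first exact: addr0.
    by move=> i /negbTE ->.
  rewrite big_seq big1// => i iX; case: eqP => // iB.
  by rewrite -iB iX in BX.
exists eta.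
  exists (size X), (fun i => xi (rep (nth set0 X i))),
    (fun i => delta R H (rep (nth set0 X i))); split.
    move=> i; exists (rep (nth set0 X i)) => //=.
    by have [] := XP _ (mem_nth set0 (ltn_ord i)).
  by apply/funext => g; rewrite /eta (big_nth set0) big_mkord.
apply: (@le_lt_trans _ _ (e / 2)%:E); last first.
  by rewrite lte_fin ltr_pdivrMr// ltr_pMr// ltr1n.
apply/l2norm_leP; first exact: ltW.
move=> Y YH; apply: le_trans (tail Y YH); rewrite [leRHS]big_mkcond /=.
rewrite !big_seq; apply: ler_sum => B /YH rB /=.
rewrite etaE// /X mem_filter asboolT//= /cutoff in_bool_set.
have nn := sqr_ge0 (normc (xi (rep B))).
case: (boolP (B \in X0)) => BX0; case: (boolP (L (rep B) <= r)) => /= Lr;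
  by rewrite ?subrr ?subr0 ?normc0 ?expr0n.
Qed.

(** Orthogonality to [delta g] forces any candidate projection to agree with [xi] at
    [g] when [L g <= r], and membership in the ball space forces it to vanish
    elsewhere; the cutoff meets both requirements. *)
Lemma Pball_cutoff r xi : ell2 H xi -> Pball H L r xi = cutoff [set g | L g <= r] xi.
Proof.
have conj0 : conjc 0 = 0 :> R[i] by rewrite /conjc /= oppr0.
have conj1 : conjc 1 = 1 :> R[i] by rewrite /conjc /= oppr0.
move=> xiE; have [xiH _] := xiE; rewrite /Pball /orthproj -/(ball_space r).
set S := [set g | L g <= r]; set Q := [set eta | _].
have Qcut : Q (cutoff S xi).
  split; first exact: ball_space_cutoff.
  move=> zeta zetaV; have term0 B :
      (xi \- cutoff S xi) (rep B) * conjc (zeta (rep B)) = 0.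
    rewrite /= /cutoff in_bool_set; case: ifPn => [_|]; first by rewrite subrr mul0r.
    by rewrite -ltNge => rB; rewrite (ball_space_supp zetaV rB) conj0 mulr0.
  by rewrite /inner (csum_single (rcosets_rcoset H 1%g)).
have := xgetPex (fun=> 0) (ex_intro _ _ Qcut).
set eta := xget _ _ => -[etaV orth]; apply/funext => g.
rewrite /cutoff in_bool_set; case: ifPn => [gr|]; last first.
  by rewrite -ltNge; exact: ball_space_supp.
have etaH : left_invariant H eta by case: etaV => -[].
have := orth _ (ball_space_delta gr).
have gg : rcosets H (rcoset H g) by exact: rcosets_rcoset.
rewrite /inner (csum_single gg).
  rewrite deltaE (rcoset_rep gg) eqxx conj1 mulr1 => /eqP.
  by rewrite subr_eq0 !left_invariant_rep// => /eqP.
move=> B rB Bg; rewrite deltaE (rcoset_rep rB) (negbTE Bg).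
by rewrite conj0 mulr0.
Qed.

End Projections.

(** * Rapidly decreasing functions lie in the Jolissaint algebra *)

Section RapidDecayInJolissaint.
Variables (R : realType) (G : groupType) (H : groupClosed G) (L : G -> R).
Hypothesis lf : length_function H L.
Implicit Types f xi : G -> R[i].

Lemma ell2_cutoff_length (p : pred R) xi :
  ell2 H xi -> ell2 H (cutoff [set g | p (L g)] xi).
Proof.
apply: ell2_cutoff; apply: bi_invariant_left.
exact: length_set_bi_invariant.
Qed.

Lemma Pcompl_cutoff r xi : ell2 H xi ->
  Pcompl H L r xi = cutoff [set g | r < L g] xi.
Proof.
move=> xiE; apply/funext => g; rewrite /Pcompl /= Pball_cutoff// /cutoff !in_bool_set.
by case: (leP (L g) r); rewrite ?subrr ?subr0.
Qed.

(** If [xi] is supported in [S], the value at [g] of the convolution only sees [f] on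
    the set [S'] of those [x] for which [x^-1 g] can lie in [S]. *)
Lemma conv_term_cutoff f xi g (S S' : set G) :
  (forall x, (x^-1 * g)%g \in S -> x \in S') ->
  conv_term H (cutoff S' f) (cutoff S xi) g = conv_term H f (cutoff S xi) g.
Proof.
move=> SS'; apply/funext => A; rewrite /conv_term /cutoff; case: ifP => // _.
case: ifPn => // AS'; rewrite mul0r; case: ifPn => AS; last by rewrite mulr0.
by rewrite SS' in AS'.
Qed.

(** Where [L > r] one has [1 <= r^(-2t) (1 + L)^(2t)]. *)
Lemma snorm_far (s t r : R) f (K : R) : 0 <= t -> 0 < r -> 0 <= K ->
  (snorm H L (s + t) f <= K%:E)%E ->
  (snorm H L s (cutoff [set g | (r < L g)%R] f) <= (K * r `^ (- t))%:E)%E.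
Proof.
move=> t0 r0 K0 /(snorm_leP _ _ _ _ K0) fK.
have [L0 _ _ _ _] := lf.
apply/snorm_leP; first by rewrite mulr_ge0 ?powR_ge0.
move=> X XH; rewrite exprMn [leRHS]mulrC -ler_pdivrMl ?exprn_gt0 ?powR_gt0//.
apply: le_trans (fK X XH); rewrite mulr_sumr; apply: ler_sum => B _.
rewrite /cutoff in_bool_set; case: ifPn => [rB|_]; last first.
  by rewrite normc0 expr0n mul0r mulr0 mulr_ge0 ?sqr_ge0 ?powR_ge0.
rewrite mulrCA ler_wpM2l ?sqr_ge0// mulrC.
have L1 : 0 < 1 + L (rep B) by rewrite ltr_pwDl.
rewrite mulrDr powRD ?(gt_eqF L1) ?implybT// ler_wpM2l ?powR_ge0//.
rewrite powRN -exprVn invrK -powR_mulrn ?powR_ge0// -powRrM mulrC.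
rewrite ge0_ler_powR ?nnegrE//; first by rewrite mulr_ge0.
- exact: ltW.
- exact: ltW.
- by rewrite ltW// (lt_le_trans rB)// lerDr.
Qed.

Variables (c s : R).
Hypotheses (hp : hecke_pair H) (c0 : 0 < c) (s0 : 0 < s).
Hypothesis RD : forall f, hecke_alg H f ->
  (opnorm H (lambda H f) <= c%:E * snorm H L s f)%E.

(** An element that moves a point of the ball of radius [r] outside the ball of
    radius [N], or back, has length greater than [N - r]. So both corners are
    dominated by convolution with the part of [f] where [L > N - r]. *)
Lemma conv_op_off_diagonal f (r N K : R) : Hs H L s f -> 0 <= K ->
  (snorm H L s (cutoff [set g | (N - r < L g)%R] f) <= K%:E)%E ->
  (opnorm H (Pcompl H L N \o conv_op H f \o Pball H L r) <= (c * K)%:E)%E /\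
  (opnorm H (Pball H L r \o conv_op H f \o Pcompl H L N) <= (c * K)%:E)%E.
Proof.
move=> fHs K0 farK; have [L0 LM LV _ _] := lf; have [fH _] := fHs.
have [opE _ _] := conv_op_bounded hp c0 RD fHs.
have farH : bi_invariant H (cutoff [set g | N - r < L g] f).
  apply: bi_invariant_cutoff => //.
  exact: (length_set_bi_invariant lf (fun x => N - r < x)).
have far_le (p : pred R) xi : ell2 H xi -> (l2norm H xi <= 1)%E ->
    (l2norm H (conv_op H (cutoff [set g | (N - r < L g)%R] f)
       (cutoff [set g | p (L g)] xi)) <= (c * K)%:E)%E.
  move=> xiE xi1.
  apply: (opnorm_leP _ _ _).1 (conv_op_opnorm hp c0 RD farH K0 farK) _ _ _.
    exact: ell2_cutoff_length.
  by apply: le_trans xi1; apply: l2norm_mono => B _; exact: normc_cutoff_le.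
split; apply/opnorm_leP => xi xiE xi1 /=.
  have ballE := ell2_cutoff_length (fun x => x <= r) xiE.
  rewrite (Pball_cutoff lf _ xiE) Pcompl_cutoff; last exact: opE.
  apply: le_trans (far_le (fun x => x <= r) _ xiE xi1); apply: l2norm_mono => B rB.
  rewrite {1}/cutoff in_bool_set; case: ifPn => [NB|_]; last by rewrite normc0 normc_ge0.
  rewrite /conv_op rep_rcoset_rep// conv_term_cutoff// => x.
  rewrite !in_bool_set => xr; rewrite ltrBlDr (lt_le_trans NB)//.
  by rewrite -{1}(mulVKg x (rep B)) (le_trans (LM _ _))// lerD2l.
have complE := ell2_cutoff_length (fun x => N < x) xiE.
rewrite (Pcompl_cutoff _ xiE) (Pball_cutoff lf); last exact: opE.
apply: le_trans (far_le (fun x => N < x) _ xiE xi1); apply: l2norm_mono => B rB.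
rewrite {1}/cutoff in_bool_set; case: ifPn => [Br|_]; last by rewrite normc0 normc_ge0.
rewrite /conv_op rep_rcoset_rep// conv_term_cutoff// => x.
rewrite !in_bool_set => Nx; rewrite ltrBlDr (lt_le_trans Nx)//.
by rewrite (le_trans (LM _ _))// LV lerD2l.
Qed.

(** With [r = N - N^alpha] and [t = q / alpha], the decay factor [(N^alpha)^(-t)] is
    exactly [N^(-q)]. *)
Lemma Hinf_sub_Tinf f : Hinf H L f -> Tinf H L (conv_op H f).
Proof.
move=> fHinf; have fHs t : 0 <= t -> Hs H L t f by exact: fHinf.
split; first by apply: (conv_op_reduced hp c0 RD); exact/fHs/ltW.
move=> alpha q /andP[al0 al1] q1.
have t0 : 0 <= q%:R / alpha by rewrite divr_ge0// ltW.
have [_ /snorm_bounded[K K0 fK]] := fHs _ (addr_ge0 (ltW s0) t0).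
apply: (@le_lt_trans _ _ (2 * (c * K))%:E); last exact: ltry.
apply: ge_ereal_sup => _ [N /= N1 <-].
have N0 : (0 : R) < N%:R by rewrite ltr0n.
have Na0 : 0 < (N%:R : R) `^ alpha by rewrite powR_gt0.
have := snorm_far t0 Na0 K0 fK.
rewrite -powRrM mulrN mulrCA divff ?gt_eqF// mulr1 powRN powR_mulrn ?ler0n//.
set K' := K * _ => far.
have K'0 : 0 <= K' by rewrite mulr_ge0// invr_ge0 exprn_ge0// ler0n.
have [] := @conv_op_off_diagonal f (N%:R - N%:R `^ alpha) N%:R K' (fHs _ (ltW s0)) K'0.
  by rewrite opprB addrC subrK.
rewrite /rho => le1 le2.
apply: (@le_trans _ _ ((N%:R ^+ q)%:E * ((c * K')%:E + (c * K')%:E))%E).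
  by rewrite lee_pmul2l ?lte_fin ?exprn_gt0// leeD.
rewrite -EFinD -EFinM lee_fin /K' le_eqVlt; apply/orP; left; apply/eqP.
by field; rewrite expf_neq0// gt_eqF.
Qed.

End RapidDecayInJolissaint.

(** * Elements of the Jolissaint algebra are rapidly decreasing *)

(** A single level suffices: for [x < 2] the constant term does, and if
    [n <= x < n + 1] with [n >= 2], then the level [n - 1] counts and [1 + x < n + 2 <= 4 (n - 1)]. *)
Lemma poly_layer_cake (R : realType) (k m : nat) (x : R) : 0 <= x -> x < m.+2%:R ->
  (1 + x) ^+ k.*2 <= 16 ^+ k *
    (1 + \sum_(1 <= N < m.+1) N%:R ^+ k.*2 * (N%:R < x)%R%:R).
Proof.
move=> x0 xm; have expE (y : R) : y ^+ k.*2 = (y ^+ 2) ^+ k by rewrite -exprM mul2n.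
have sum0 : 0 <= \sum_(1 <= N < m.+1) (N%:R : R) ^+ k.*2 * (N%:R < x)%R%:R.
  by apply: sumr_ge0 => N _; rewrite mulr_ge0// exprn_ge0.
have [x2|x2] := ltP x 2.
  apply: (@le_trans _ _ (16 ^+ k)); last by rewrite ler_peMr ?exprn_ge0// lerDl.
  rewrite expE lerXn2r ?nnegrE ?sqr_ge0//; nra.
have := truncn_itv x0; set n := Num.truncn x => /andP[nx xn].
have n2 : (2 <= n)%N by rewrite -ltnS -(ltr_nat R) (le_lt_trans x2).
have nm : (n < m.+2)%N by rewrite -(ltr_nat R) (le_lt_trans nx).
have n1 : (1 <= n.-1 < m.+1)%N by move: n2 nm; case: (n) => [|[|j]].
rewrite (bigD1_seq n.-1) ?mem_index_iota ?iota_uniq//=.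
have nE : (n%:R : R) = n.-1%:R + 1 by rewrite natr1 prednK// (leq_trans _ n2).
have nx1 : (n.-1%:R < x) by rewrite (lt_le_trans _ nx)// nE ltrDl.
rewrite nx1 mulr1; set S := \sum_(i <- _ | _) _.
have S0 : 0 <= S by apply: sumr_ge0 => N _; rewrite mulr_ge0// exprn_ge0.
have n1R : 1 <= (n.-1%:R : R) by rewrite ler1n; case/andP: n1.
apply: (@le_trans _ _ (16 ^+ k * n.-1%:R ^+ k.*2)); last first.
  by rewrite ler_wpM2l ?exprn_ge0//; lra.
rewrite !expE -exprMn lerXn2r ?nnegrE ?sqr_ge0 ?mulr_ge0 ?sqr_ge0//.
move: xn; rewrite -natr1 nE => xn.
rewrite (_ : 16 * _ = (4 * n.-1%:R) ^+ 2); last by ring.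
by rewrite ler_sqr ?nnegrE; lra.
Qed.

(** By induction the sum up to [m] is at most [2 - 1/m]. *)
Lemma sum_inv_sqr_le (R : realType) (m : nat) :
  \sum_(1 <= N < m.+1) ((N%:R : R) ^+ 2)^-1 <= 2.
Proof.
case: m => [|m]; first by rewrite big_geq// ler0n.
apply: (@le_trans _ _ (2 - m.+1%:R^-1)); last by rewrite gerBl invr_ge0.
elim: m => [|m IH]; first by rewrite big_nat1 expr1n invr1; lra.
rewrite big_nat_recr//= (le_trans (lerD IH (lexx _)))// -[m.+2%:R]natr1.
set y : R := m.+1%:R; have y0 : 0 < y by rewrite ltr0n.
rewrite -subr_ge0 (_ : _ - _ = (y * (y + 1) ^+ 2)^-1).
  by rewrite invr_ge0 mulr_ge0 ?sqr_ge0 ?ltW.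
by field; rewrite !gt_eqF// addr_gt0.
Qed.

Section JolissaintInRapidDecay.
Variables (R : realType) (G : groupType) (H : groupClosed G) (L : G -> R).
Hypotheses (hp : hecke_pair H) (lf : length_function H L).
Variable a : op R G.
Let f := a (delta R H 1%g).

Lemma reduced_hecke_ell2 : reduced_hecke H a -> ell2 H f.
Proof. by move=> [[aE _ _] _]; apply: aE; exact: delta_ell2. Qed.

(** Bi-invariance passes to pointwise limits: convolution by [f0] close to [a] gives
    [f0] close to [f = a delta_H] at every point. *)
Lemma reduced_hecke_bi_invariant : reduced_hecke H a -> bi_invariant H f.
Proof.
move=> aH; have [fL _] := reduced_hecke_ell2 aH; have [_ approx] := aH.
move=> h g k hH kH; apply/eqP; rewrite -subr_eq0; apply/eqP/eq0_normc/eqP.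
rewrite eq_le normc_ge0 andbT; apply/ler_addgt0Pl => e e0; rewrite addr0.
have e20 : 0 < e / 2 by rewrite divr_gt0.
have [f0 f0H lt_e] := approx _ e20; have [f0b _] := f0H.
have close x : normc (f x - f0 x) <= e / 2.
  apply: (@normc_le_l2norm R G H (f \- f0) x _ (ltW e20)).
    by move=> h' x' h'H /=; rewrite fL// (bi_invariant_left f0b).
  apply: le_trans (ltW lt_e).
  rewrite (_ : f \- f0 = f \- lambda H f0 (delta R H 1%g)).
    by apply: ereal_sup_ubound; exists (delta R H 1%g);
      split; [exact: delta_ell2|exact: delta_l2norm_le1].
  by apply/funext => y /=; rewrite /lambda hconv_delta.
rewrite (_ : f _ - _ = (f (h * g * k)%g - f0 (h * g * k)%g) + - (f g - f0 g)).
  rewrite (le_trans (ler_normcD _ _))// normcN.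
  by rewrite (le_trans (lerD (close _) (close _)))// -splitr.
by rewrite f0b// opprB addrA subrK.
Qed.

(** [delta_H] is fixed by the projection onto every ball of nonnegative radius, so
    the first corner of [a] applied to it is the part of [f] where [L > N]. The
    bound comes from the seminorm with [alpha = 1/2]. *)
Lemma Tinf_tail q : Tinf H L a -> (1 <= q)%N -> exists2 M : R, 0 <= M &
  forall N, (1 <= N)%N -> forall X : {fset set G}, [set` X] `<=` rcosets H ->
  \sum_(B <- X | N%:R < L (rep B)) normc (f (rep B)) ^+ 2 <= (M / N%:R ^+ q) ^+ 2.
Proof.
move=> [aH nu_fin] q1; have [L0 _ _ L1 LH] := lf.
have := nu_fin 2^-1 q; rewrite invr_gt0 ltr0n invf_lt1// ltr1n /= => /(_ isT q1).
set n := nu _ _ _ _ _ => n_fin; exists (Num.max 0 (fine n)); first by rewrite le_max lexx.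
set M := Num.max _ _ => N N1 X XH.
have N0 : 0 < (N%:R : R) ^+ q by rewrite exprn_gt0// ltr0n.
have M0 : 0 <= M by rewrite le_max lexx.
have nM : (n <= M%:E)%E.
  case: n n_fin @M {M0} => [r _|//|_] /=; last exact: leNye.
  by rewrite lee_fin le_max lexx orbT.
have dE : ell2 H (delta R H 1%g) by exact: delta_ell2.
have ball_delta : Pball H L (N%:R - N%:R `^ 2^-1) (delta R H 1%g) = delta R H 1%g.
  rewrite Pball_cutoff//; apply/funext => g; rewrite /cutoff in_bool_set.
  case: ifPn => // gr; rewrite delta1E; case: (boolP (g \in H)) => // gH.
  case/negP: gr; rewrite LH// subr_ge0 -[leRHS]powRr1// ler_powR ?ler1n//.
  by rewrite invf_le1// ler1n.
have tail : (l2norm H (cutoff [set g | (N%:R < L g)%R] f) <= (M / N%:R ^+ q)%:E)%E.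
  rewrite -(Pcompl_cutoff lf); last exact: reduced_hecke_ell2.
  rewrite EFinM muleC lee_pdivlMl//; apply: le_trans nM.
  have rho_le : (rho H L 2^-1 q N a <= n)%E by apply: ereal_sup_ubound; exists N.
  apply: le_trans rho_le; rewrite /rho; set x := opnorm _ _; set y := opnorm _ _.
  have x_ge : (l2norm H (Pcompl H L N%:R f) <= x)%E.
    rewrite /f -{1}ball_delta; apply: ereal_sup_ubound.
    by exists (delta R H 1%g) => //; split=> //; exact: delta_l2norm_le1.
  have y0 : (0 <= y)%E.
    apply: (@le_trans _ _ (l2norm H ((Pball H L (N%:R - N%:R `^ 2^-1) \o a \o
      Pcompl H L N%:R) (delta R H 1%g)))); first exact: l2norm_ge0.
    apply: ereal_sup_ubound.
    by exists (delta R H 1%g) => //; split=> //; exact: delta_l2norm_le1.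
  by rewrite lee_pmul2l ?lte_fin// (le_trans x_ge)// leeDl.
have MN0 : 0 <= M / N%:R ^+ q by rewrite divr_ge0// ltW.
apply: le_trans ((l2norm_leP _ _ MN0).1 tail X XH).
rewrite big_mkcond le_eqVlt; apply/orP; left; apply/eqP; apply: eq_bigr => B _.
by rewrite /cutoff in_bool_set; case: ifP => _; rewrite ?normc0 ?expr0n.
Qed.

(** Each level [N] contributes at most [N^(2k) M^2 N^(-2(k+1)) = M^2 / N^2], and
    these bounds are summable. *)
Lemma Tinf_sub_Hinf : Tinf H L a -> Hinf H L f.
Proof.
move=> aT t /= t0; have [aH _] := aT; split; first exact: reduced_hecke_bi_invariant.
have [L0 _ _ _ _] := lf.
have [_ /l2norm_bounded[m0 m00 /(l2norm_leP _ _ (ltW m00)) fm]] := reduced_hecke_ell2 aH.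
pose k := Num.bound t; have tk : t <= k%:R := ltW (archi_boundP t0).
have [M M0 tail] := Tinf_tail aT (ltn0Sn k).
pose K2 := 16 ^+ k * (m0 ^+ 2 + M ^+ 2 * 2).
have K20 : 0 <= K2.
  by rewrite mulr_ge0 ?exprn_ge0 ?ler0n// addr_ge0 ?sqr_ge0// mulr_ge0 ?sqr_ge0.
apply: (@le_lt_trans _ _ (Num.sqrt K2)%:E); last exact: ltry.
apply/snorm_leP => [|X XH]; first exact: sqrtr_ge0.
rewrite sqr_sqrtr//.
(* every length occurring in [X] is below [m + 1], so finitely many levels do *)
pose m := \max_(B <- X) Num.truncn (L (rep B)).
apply: (@le_trans _ _ (\sum_(B <- X) normc (f (rep B)) ^+ 2 * (16 ^+ k *
    (1 + \sum_(1 <= N < m.+1) N%:R ^+ k.*2 * (N%:R < L (rep B))%R%:R)))).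
  rewrite !big_seq; apply: ler_sum => B BX; rewrite ler_wpM2l ?sqr_ge0//.
  apply: le_trans (poly_layer_cake _ (L0 _) _); last first.
    have /andP[_ lt_tr] := truncn_itv (L0 (rep B)); apply: lt_trans lt_tr _.
    by rewrite ltr_nat !ltnS; apply: leq_bigmax_seq.
  rewrite -powR_mulrn ?addr_ge0// -mul2n natrM ler_powR ?lerDl//.
  by rewrite ler_wpM2l.
under eq_bigr do rewrite mulrCA mulrDr mulr1.
rewrite -mulr_sumr big_split /= /K2 ler_wpM2l ?exprn_ge0// lerD//; first exact: fm.
under eq_bigr do rewrite mulr_sumr.
rewrite exchange_big /=.
apply: (@le_trans _ _ (\sum_(1 <= N < m.+1) M ^+ 2 * ((N%:R : R) ^+ 2)^-1)).
  rewrite !big_nat; apply: ler_sum => N /andP[N1 _].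
  have Nn0 : (N%:R : R) != 0 by rewrite pnatr_eq0 -lt0n.
  under eq_bigr do rewrite mulrCA.
  rewrite -mulr_sumr.
  have -> : \sum_(B <- X) normc (f (rep B)) ^+ 2 * (N%:R < L (rep B))%R%:R =
            \sum_(B <- X | N%:R < L (rep B)) normc (f (rep B)) ^+ 2.
    rewrite [RHS]big_mkcond; apply: eq_bigr => B _.
    by case: ifP => _; rewrite ?mulr1 ?mulr0.
  apply: (@le_trans _ _ (N%:R ^+ k.*2 * (M / N%:R ^+ k.+1) ^+ 2)).
    by rewrite ler_wpM2l ?exprn_ge0//; exact: tail.
  rewrite le_eqVlt; apply/orP; left; apply/eqP.
  rewrite (exprS _ k) -muln2 exprM; set y := _ ^+ k.
  have y0 : y != 0 by rewrite expf_neq0.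
  by field; rewrite Nn0 y0.
by rewrite -mulr_sumr ler_wpM2l ?sqr_ge0// sum_inv_sqr_le.
Qed.

End JolissaintInRapidDecay.

Theorem proposition3p7 (R : realType) (G : groupType) (H : groupClosed G)
    (L : G -> R) :
  hecke_pair H -> length_function H L -> property_RD H L ->
  [set a (delta R H 1%g) | a in Tinf H L] = Hinf H L.
Proof.
move=> hp lf [c [s [c0 s0 RD]]]; apply/seteqP; split=> [_ [a aT <-]|f fH].
  exact: Tinf_sub_Hinf.
have [fb _] := fH 0 (lexx 0).
exists (conv_op H f); last exact: conv_op_delta.
exact: (Hinf_sub_Tinf lf hp c0 s0 RD).
Qed.
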